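(* Let $X$ be $\mathbb{R}_+=(0,\infty)$ equipped with either the Euclidean topology or the density topology (in either case $X$ is a Baire space). Suppose that (i) $\{h_i : i\in\mathbb{I}\}$ is a weakly Archimedean family of self-homeomorphisms of $X$, indexed by the countable linearly ordered set $\mathbb{I}$; and (ii) $S_k$ ($k=1,2,\dots$) are essentially unbounded Baire sets in $X$. Then for quasi all $\eta\in X$ and all $k\in\mathbb{N}$ there exists an unbounded subset $\mathbb{J}^k_\eta$ of $\mathbb{I}$ with $$\{h_j(\eta): j\in \mathbb{J}^k_\eta\}\subset S_k .$$ Equivalently, if (i) holds and (ii)$'$ $A_k$ ($k=1,2,\dots$) are Baire sets in $X$ all of which accumulate essentially at $0$, then for quasi all $\eta\in X$ and every $k=1,2,\dots$ there exists an unbounded subset $\mathbb{J}^k_\eta$ of $\mathbb{I}$ with $$\{h_j(\eta)^{-1}: j\in \mathbb{J}^k_\eta\}\subset A_k .$$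
   Context: $\mathbb{R}_+$ denotes the strictly positive reals. A measurable set $U$ is open in the density topology if each of its points $t$ is a density point of $U$, i.e. $\lim_{\delta\downarrow 0}|U\cap(t-\delta/2,t+\delta/2)|/\delta=1$. ''Baire set'' means a set with the Baire property in the topology of $X$, and ''meagre'' means meagre in the topology of $X$; for the density topology the Baire sets are exactly the Lebesgue measurable sets and the meagre sets are exactly the Lebesgue null sets. ''Quasi all'' means all except for a meagre set (meagre in $X$). A Baire set $S\subseteq X$ is essentially unbounded if for each $m\in\mathbb{N}$ the set $S\setminus(-m,m)$ is non-meagre in $X$. A set $A\subset\mathbb{R}_+$ accumulates essentially at $0$ if $A^{-1}:=\{a^{-1}:a\in A\}$ is essentially unbounded. $\mathbb{I}$ is $\mathbb{N}$, $\mathbb{Q}$ or $\mathbb{Q}_+$ (the positive rationals), with the ordering induced from the reals; a subset of $\mathbb{I}$ is unbounded if it is unbounded on the right. A family $\{h_i:i\in\mathbb{I}\}$ of self-homeomorphisms of $X$ is weakly Archimedean if for each non-empty open set $V$ in $X$ and each $j\in\mathbb{I}$ the open set $U_j(V):=\bigcup_{i\ge j}h_i(V)$ meets every essentially unbounded Baire set in $X$. *)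

(* Defs.v *)
From HB Require Import structures.
From mathcomp Require Import all_boot all_order all_algebra.
From mathcomp Require Import all_classical all_reals all_analysis.
From mathcomp Require Import measurable_realfun.

Set Implicit Arguments.
Unset Strict Implicit.
Unset Printing Implicit Defensive.

Import Order.TTheory GRing.Theory Num.Theory.
Import numFieldNormedType.Exports.

Local Open Scope classical_set_scope.
Local Open Scope ring_scope.

Section category.
Context {T : topologicalType}.

Definition nowhere_dense (A : set T) := interior (closure A) = set0.

Definition meagre (A : set T) :=
  exists F : (set T)^nat, (forall n, nowhere_dense (F n)) /\ A = \bigcup_n F n.

(* In the sense of the property of Baire, not of the Baire sigma-algebra. *)
Definition baire_set (A : set T) :=
  exists2 U : set T, open U & meagre (A `+` U).

Definition quasi_all (P : T -> Prop) := meagre [set x | ~ P x].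

Definition self_homeomorphism (f : T -> T) :=
  continuous f /\
  exists g : T -> T, [/\ continuous g, cancel f g & cancel g f].

End category.

Section density_opens.
Context {R : realType}.
Local Notation mu := (@completed_lebesgue_measure R).

Definition Lebesgue_measurable (A : set R) :=
  completed_algebra_gen (@lebesgue_measure R) A.

Definition density_point (U : set R) (t : R) :=
  (mu (U `&` [set` `]t - d / 2, t + d / 2[%R]) * (d^-1)%:E)%E
    @[d --> 0^'+] --> 1%:E.

Definition density_open (U : set R) :=
  Lebesgue_measurable U /\ forall t, U t -> density_point U t.

Let le_mu (A B : set R) : A `<=` B -> (mu A <= mu B)%E.
Proof. exact: (@le_outer_measure _ _ (wlength idfun)^*%mu). Qed.

Let muU2 (A B : set R) : (mu (A `|` B) <= mu A + mu B)%E.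
Proof. exact: (@outer_measureU2 _ _ (wlength idfun)^*%mu). Qed.

Let mu_window (t d : R) : 0 < d ->
  mu (`]t - d / 2, t + d / 2[ : set R) = d%:E.
Proof.
move=> d0; transitivity (lebesgue_measure (ball t (d / 2))).
  by rewrite ball_itv.
by rewrite lebesgue_measure_ball ?divr_ge0 ?ltW// mulr2n -splitr.
Qed.

Let mu_window_le1 (U : set R) (t d : R) : 0 < d ->
  (mu (U `&` [set` `]t - d / 2, t + d / 2[%R]) * (d^-1)%:E <= 1%:E)%E.
Proof.
move=> d0; rewrite lee_pdivrMr// mul1e -(mu_window t d0).
by apply: le_mu; exact: subIsetr.
Qed.

Let density_pointS (U V : set R) t :
  mu (U `\` V) = 0%E -> density_point U t -> density_point V t.
Proof.
move=> UV Ut; apply: (squeeze_cvge _ Ut (@cvg_cst _ 1%:E _ _ _)).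
near=> d; rewrite mu_window_le1// andbT lee_pmul2r// ?lte_fin ?invr_gt0//.
rewrite -[leRHS]adde0 -UV.
apply: (le_trans _ (muU2 _ _)); apply: le_mu => x [Ux Wx].
by have [Vx|nVx] := pselect (V x); [left|right].
Unshelve. all: by end_near. Qed.

Lemma density_openT : density_open setT.
Proof.
split.
  exists setT => //; exists set0; first exact: negligible_set0.
  by rewrite setU0.
move=> t _; apply: cvg_near_cst; near=> d.
have d0 : 0 < d by [].
by rewrite setTI mu_window// -EFinM divff ?gt_eqF.
Unshelve. all: by end_near. Qed.

Let caratheodoryE (A X : set R) : Lebesgue_measurable A ->
  mu X = (mu (X `&` A) + mu (X `&` ~` A))%E.
Proof.
rewrite /Lebesgue_measurable -g_sigma_completed_algebra_genE.
by rewrite completed_caratheodory_measurable; apply.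
Qed.

Lemma density_openI : setI_closed (density_open : set (set R)).
Proof.
move=> U V [mU dU] [mV dV]; split.
  move: mU mV; rewrite /Lebesgue_measurable -g_sigma_completed_algebra_genE.
  exact: measurableI.
move=> t [Ut Vt].
pose r (W : set R) d := (mu (W `&` [set` `]t - d / 2, t + d / 2[%R]) *
  (d^-1)%:E)%E.
have UVt : (r U d + r V d - 1%:E)%E @[d --> 0^'+] --> 1%:E.
  rewrite -[X in _ --> X](@addeK _ 1%:E 1%:E)//.
  apply: cvgeB => //; last exact: cvg_cst.
  by apply: cvgeD => //; [exact: dU|exact: dV].
apply: (squeeze_cvge _ UVt (@cvg_cst _ 1%:E _ _ _)).
near=> d.
have d0 : 0 < d by [].
rewrite mu_window_le1// andbT leeBlDr// /r -muleDl//; last first.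
  by rewrite ge0_adde_def// inE measure_ge0.
have -> : (1%:E = mu [set` `]t - d / 2, t + d / 2[%R] * (d^-1)%:E)%E.
  by rewrite mu_window// -EFinM divff ?gt_eqF.
rewrite -muleDl//; last by rewrite ge0_adde_def// inE measure_ge0.
rewrite lee_pmul2r// ?lte_fin ?invr_gt0//.
set W := [set` _].
rewrite (caratheodoryE W mU) (caratheodoryE (V `&` W) mU).
rewrite [leLHS]addeC -[leLHS]addeA leeD//.
  by apply: le_mu => x; rewrite /setI/=; tauto.
by rewrite addeC leeD//; apply: le_mu => x; rewrite /setI/=; tauto.
Unshelve. all: by end_near. Qed.

Let lebesgue_density_point (K : set R) : measurable K ->
  negligible (@lebesgue_measure R) [set x | ~ K x /\ density_point K x].
Proof.
move=> mK; apply: negligibleS (lebesgue_density mK) => x [nKx Kx] /=.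
rewrite indicE memNset//= => K0.
suff Kx0 : (mu (K `&` [set` `]x - d / 2, x + d / 2[%R]) * (d^-1)%:E)%E
    @[d --> 0^'+] --> 0%:E.
  have := cvg_lim (@ereal_hausdorff R) Kx0.
  rewrite (cvg_lim (@ereal_hausdorff R) Kx).
  move=> /(_ (at_right_proper_filter _)) /eqP.
  by rewrite eqe oner_eq0.
have K0' : (lebesgue_measure (K `&` ball x (d / 2)) *
    (lebesgue_measure (ball x (d / 2)))^-1)%E @[d --> 0^'+] --> 0%:E.
  apply: (@cvg_comp _ _ _ (fun d : R => d / 2) _ _ _ _ _ K0).
  move=> A [e /= e0 eA]; exists e => // d.
  move=> /= de d0; apply: eA; last by rewrite /= divr_gt0.
  apply: le_lt_trans de.
  rewrite !sub0r !normrN normrM [`|2^-1|]ger0_norm ?invr_ge0//.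
  by rewrite ler_pdivrMr// ler_peMr// ler1n.
apply: cvg_trans K0'; apply: near_eq_cvg; near=> d.
have d0 : 0 < d by [].
rewrite /= lebesgue_measure_ball ?divr_ge0 ?ltW// [d / 2 *+ 2]mulr2n -splitr.
by rewrite ball_itv inver gt_eqF.
Unshelve. all: by end_near. Qed.

Let measurable_hull (E : set R) : (mu E < +oo)%E ->
  exists G, [/\ measurable G, E `<=` G &
    forall A, Lebesgue_measurable A -> A `&` E = set0 ->
    mu (A `&` G) = 0%E].
Proof.
move=> Efin; have [F [oF EF FE]] := outer_measure_Gdelta E.
pose G := \bigcap_i F i.
have mG : measurable G.
  by apply: bigcapT_measurable => i; exact: open_measurable.
exists G; split => // A mA AE.
have muGE : mu G = mu E := FE.
have muGA : (mu E <= mu (G `&` ~` A))%E.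
  apply: le_mu => x Ex; split; first exact: EF.
  by move=> Ax; have : (A `&` E) x by []; rewrite AE.
have muEfin : mu E \is a fin_num by rewrite ge0_fin_numE.
have := caratheodoryE G mA; rewrite muGE setIC => muEq.
apply/eqP; rewrite eq_le measure_ge0 andbT.
rewrite -(leeD2rE _ _ muEfin) add0e {2}muEq.
exact: leeD.
Qed.

Lemma density_open_bigcup (I : Type) (f : I -> set R) :
  (forall i, density_open (f i)) -> density_open (\bigcup_i f i).
Proof.
move=> fo; set U := \bigcup_i f i.
pose E n : set R := ~` U `&` `[- n%:R, n%:R].
have Efin n : (mu (E n) < +oo)%E.
  apply: (@le_lt_trans _ _ (@lebesgue_measure R `[- n%:R, n%:R])).
    by apply: le_mu; exact: subIsetr.
  by rewrite lebesgue_measure_itv/=; case: ifPn; rewrite ?ltry.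
have [G GP] := choice (fun n => measurable_hull (Efin n)).
pose K := ~` (\bigcup_n G n).
have mK : measurable K.
  apply: measurableC; apply: bigcupT_measurable => n.
  by have [] := GP n.
have KU : K `<=` U.
  move=> x Kx; apply: contrapT => nUx; apply: Kx.
  have [_ EG _] := GP (Num.bound `|x|).
  exists (Num.bound `|x|) => //; apply: EG; split => //=.
  by rewrite in_itv/= -ler_norml ltW// archi_boundP.
have fK i : mu (f i `\` K) = 0%E.
  apply: (negligible_outer_measure _).1.
  rewrite setDE setCK setI_bigcupr; apply: negligible_bigcup => n.
  apply: (negligible_outer_measure _).2.
  have [_ _ GA] := GP n; apply: GA; first exact: (fo i).1.
  by apply/seteqP; split => // x [fx [nUx _]]; apply: nUx; exists i.
split.
  exists K => //; exists (U `\` K); last by rewrite setDUK.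
  apply: negligibleS (lebesgue_density_point mK) => x [[i _ fx] nKx].
  by split => //; apply: density_pointS (fK i) ((fo i).2 _ fx).
move=> t [i _ ft]; apply: density_pointS ((fo i).2 _ ft).
rewrite (_ : _ `\` _ = set0) ?measure0//.
by apply/seteqP; split => // x [fx nUx]; apply: nUx; exists i.
Qed.

End density_opens.

Variant line_topology := Euclidean | Density.

Definition real_line (R : realType) (tau : line_topology) : Type := R.

Section real_line.
Context {R : realType} {tau : line_topology}.

Definition line_open : set (set R) :=
  match tau with
  | Euclidean => open
  | Density => density_open
  end.

Let line_openT : line_open setT.
Proof.
by rewrite /line_open; case: tau; [exact: openT|exact: density_openT].
Qed.

Let line_openI : setI_closed line_open.
Proof.
by rewrite /line_open; case: tau; [exact: openI|exact: density_openI].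
Qed.

Let line_open_bigcup (I : Type) (f : I -> set R) :
  (forall i, line_open (f i)) -> line_open (\bigcup_i f i).
Proof.
rewrite /line_open; case: tau => fo; last exact: density_open_bigcup.
by apply: bigcup_open => i _; exact: fo.
Qed.

HB.instance Definition _ := Choice.copy (real_line R tau) R.
HB.instance Definition _ := isOpenTopological.Build (real_line R tau)
  line_openT line_openI line_open_bigcup.

End real_line.

(* The subspace topology is the intended one, the half-line being open for
   both topologies of the line. *)
Definition positive_line (R : realType) (tau : line_topology) :
  set (real_line R tau) := [set x | 0 < (x : R)].

Definition Rplus (R : realType) (tau : line_topology) : topologicalType :=
  set_type (@positive_line R tau).

Section Rplus.
Context {R : realType} {tau : line_topology}.
Local Notation X := (Rplus R tau).

Definition Rplus_val (x : X) : R := \val x.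

Lemma Rplus_val_gt0 (x : X) : 0 < Rplus_val x.
Proof. exact: set_valP x. Qed.

Definition Rplus_inv (x : X) : X :=
  @SigSub _ _ _ ((Rplus_val x)^-1 : real_line R tau)
    (mem_set (etrans (invr_gt0 (Rplus_val x)) (Rplus_val_gt0 x))).

(* Meant for Baire sets S; that S is Baire is a separate hypothesis. *)
Definition essentially_unbounded (S : set X) := forall m : nat, (0 < m)%N ->
  ~ meagre (S `\` [set x | - m%:R < Rplus_val x < m%:R]).

Definition essential_accumulation_at_0 (A : set X) :=
  essentially_unbounded (Rplus_inv @` A).

End Rplus.

(* The index sets, as subsets of rat: the positive integers, the rationals,
   the positive rationals. *)
Variant index_kind := IndexN | IndexQ | IndexQpos.

Definition is_index (K : index_kind) (q : rat) : bool :=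
  match K with
  | IndexN => (q \is a Num.nat) && (0 < q)
  | IndexQ => true
  | IndexQpos => 0 < q
  end.

Definition index_type (K : index_kind) : Type := {q : rat | is_index K q}.

Definition unbounded_indices (K : index_kind) (J : set (index_type K)) :=
  ~ has_ubound [set val j | j in J].

Definition weakly_archimedean (R : realType) (tau : line_topology)
    (K : index_kind) (h : index_type K -> Rplus R tau -> Rplus R tau) :=
  forall (V : set (Rplus R tau)) (j : index_type K), open V -> V !=set0 ->
  forall S : set (Rplus R tau), baire_set S -> essentially_unbounded S ->
    (\bigcup_(i in [set i | val j <= val i]) h i @` V) `&` S !=set0.

(* Main.v *)
Require Import Defs.
From mathcomp Require Import all_boot all_order all_algebra.
From mathcomp Require Import all_classical all_reals all_analysis.
From mathcomp Require Import measurable_realfun ring lra.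

Set Implicit Arguments.
Unset Strict Implicit.
Unset Printing Implicit Defensive.

Import Order.TTheory GRing.Theory Num.Theory.
Import numFieldNormedType.Exports.

Local Open Scope classical_set_scope.
Local Open Scope ring_scope.

(** Fix one Baire essentially unbounded set [S] and one index [j].  Up to a
    meagre set, [S] is an open set [U], and [U] is again essentially unbounded.
    The set [W] of the points sent into [U] by some [h i] with [j <= i] is
    open; and the weakly Archimedean hypothesis, applied to an arbitrary
    non-empty open [V] and to the set [U], says that [W] meets [V].  So [W] is
    open and dense, its complement is nowhere dense, and the points of [W] that
    miss [S] lie in the countable union of the preimages by the [h i] of the
    meagre set [S `+` U], which is meagre because the [h i] are homeomorphisms.
    Hence quasi all points are sent into [S] by some [h i] with [j <= i]
    ([quasi_all_hit]).  Intersecting over the countably many pairs of a set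
    [S k] and an index [j] makes the hitting indices cofinal, hence unbounded,
    for every [k] at once ([quasi_all_unbounded_hits]).

    The statement about accumulation at [0] is the previous one for the inverses
    of the sets [A k].  What has to be checked is that these are Baire sets,
    which follows from inversion being a homeomorphism of the half-line
    ([Rplus_inv_homeo]).  This is immediate for the Euclidean topology.  For
    the density topology it is a fact about Lebesgue outer measure: away from
    [0], inversion is Lipschitz, so it multiplies outer measures by a bounded
    factor at most ([inv_outer_measure]).  Consequently it preserves null sets,
    hence Lebesgue measurable sets, and it also preserves points at which the
    complement of a set has density [0] ([density_point_inv]). *)

(** * Meagre sets and homeomorphisms *)

Section category_lemmas.
Context {T : topologicalType}.

Lemma nowhere_denseS (A B : set T) :
  A `<=` B -> nowhere_dense B -> nowhere_dense A.
Proof.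
move=> AB B0; rewrite /nowhere_dense -subset0 -B0; apply: interiorS.
exact: closureS.
Qed.

Lemma meagreS (A B : set T) : A `<=` B -> meagre B -> meagre A.
Proof.
move=> AB [F [F0 BF]]; exists (fun n => A `&` F n); split.
  by move=> n; apply: nowhere_denseS (F0 n); exact: subIsetr.
by rewrite -setI_bigcupr -BF setIidl.
Qed.

Lemma nowhere_dense0 : nowhere_dense (set0 : set T).
Proof. by rewrite /nowhere_dense closure0 interior0. Qed.

Lemma nowhere_dense_meagre (A : set T) : nowhere_dense A -> meagre A.
Proof.
by move=> A0; exists (fun=> A); split=> //; rewrite bigcup_const//; exists 0%N.
Qed.

Lemma meagre_bigcup (I : countType) (A : I -> set T) :
  (forall i, meagre (A i)) -> meagre (\bigcup_i A i).
Proof.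
move=> /choice[F FA].
exists (fun n => if @unpickle (I * nat)%type n is Some p then F p.1 p.2
                 else set0); split.
  move=> n; case: unpickle => [[i m]|]; first exact: (FA i).1.
  exact: nowhere_dense0.
apply/seteqP; split=> [x [i _]|x [n _]].
  rewrite (FA i).2 => -[m _ Fx]; exists (pickle (i, m)) => //.
  by rewrite pickleK.
case: unpickle => [[i m] /= Fx|//]; exists i => //.
by rewrite (FA i).2; exists m.
Qed.

Lemma meagreU (A B : set T) : meagre A -> meagre B -> meagre (A `|` B).
Proof.
move=> mA mB; have -> : A `|` B = \bigcup_(b : bool) (if b then A else B).
  apply/seteqP; split=> [x [Ax|Bx]|x [[] _ ?]];
    by [exists true|exists false|left|right].
by apply: meagre_bigcup => -[].
Qed.

(** Density of [U] is spelled out as meeting every non-empty open set because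
    that is what the weakly Archimedean condition delivers. *)
Lemma nowhere_denseC (U : set T) : open U ->
  (forall V, open V -> V !=set0 -> V `&` U !=set0) -> nowhere_dense (~` U).
Proof.
move=> oU dU; rewrite /nowhere_dense closure_setC ((interior_id U).1 oU).
apply: contrapT => /eqP/set0P /(dU _ (open_interior _))[x].
by case=> /interior_subset nUx Ux; exact: nUx.
Qed.

Lemma open_baire_set (U : set T) : open U -> baire_set U.
Proof.
move=> oU; exists U => //; rewrite setYK; apply: nowhere_dense_meagre.
exact: nowhere_dense0.
Qed.

Lemma closure_preimage (f : T -> T) (A : set T) : continuous f ->
  closure (f @^-1` A) `<=` f @^-1` closure A.
Proof.
move=> cf; rewrite [closure (_ @^-1` _)]closureE.
apply: smallest_sub; first by apply: closed_comp => //; exact: closed_closure.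
by apply: preimage_subset; exact: subset_closure.
Qed.

Lemma nowhere_dense_preimage (f : T -> T) (A : set T) :
  self_homeomorphism f -> nowhere_dense A -> nowhere_dense (f @^-1` A).
Proof.
move=> [cf [g [cg fg gf]]] A0; rewrite /nowhere_dense -subset0 => x.
move=> /(interiorS (closure_preimage cf)) fAx.
have : open (g @^-1` (f @^-1` closure A)°).
  by apply: open_comp => [y _|]; [exact: cg|exact: open_interior].
move=> og; suff : (closure A)° (f x) by rewrite A0.
rewrite /interior nbhsE; exists (g @^-1` (f @^-1` closure A)°).
  by split=> //=; rewrite fg.
by move=> y /= /interior_subset /=; rewrite gf.
Qed.

Lemma meagre_preimage (f : T -> T) (A : set T) :
  self_homeomorphism f -> meagre A -> meagre (f @^-1` A).
Proof.
move=> hf [F [F0 ->]]; exists (fun n => f @^-1` F n); split.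
  by move=> n; exact: nowhere_dense_preimage.
by rewrite preimage_bigcup.
Qed.

Lemma baire_set_preimage (f : T -> T) (A : set T) :
  self_homeomorphism f -> baire_set A -> baire_set (f @^-1` A).
Proof.
move=> hf [U oU mAU]; exists (f @^-1` U).
  by apply: open_comp => // y _; exact: hf.1.
exact: (meagre_preimage hf mAU).
Qed.

(** The points sent into [U] form an open dense set, and passing from [U] to
    [S] costs a countable union of homeomorphic preimages of a meagre set. *)
Lemma quasi_all_hit (I : countType) (D : set I) (h : I -> T -> T)
    (S U : set T) :
  (forall i, self_homeomorphism (h i)) -> open U -> meagre (S `+` U) ->
  (forall V, open V -> V !=set0 ->
     (\bigcup_(i in D) h i @` V) `&` U !=set0) ->
  quasi_all (fun x => exists2 i, D i & S (h i x)).
Proof.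
move=> hh oU mSU hU; set W := \bigcup_(i in D) h i @^-1` U.
have W0 : meagre (~` W).
  apply/nowhere_dense_meagre/nowhere_denseC.
    by apply: bigcup_open => i _; apply: open_comp => // y _; exact: (hh i).1.
  move=> V oV V0; have [_ [[i Di [x Vx <-]] Ux]] := hU _ oV V0.
  by exists x; split => //; exists i.
have E0 : meagre (\bigcup_i h i @^-1` (S `+` U)).
  by apply: meagre_bigcup => i; exact: meagre_preimage.
apply: meagreS (meagreU W0 E0) => x nSx /=.
have [[i Di Ux]|] := pselect (W x); last by left.
right; exists i => //; right; split => // Sx.
by apply: nSx; exists i.
Qed.

End category_lemmas.

(** * Inversion and Lebesgue measure *)

Section density_of_inverse.
Context {R : realType}.
Local Notation mu := (@completed_lebesgue_measure R).

Let le_mu (A B : set R) : A `<=` B -> (mu A <= mu B)%E.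
Proof. exact: (@le_outer_measure _ _ (wlength idfun)^*%mu). Qed.

(** Cover [E] by open intervals: the image of the part of [E] in an interval of
    length [l] lies within [L * l] of any one of its points.  Centring at a
    point of the image is what costs the factor [2], which is harmless since
    only comparability of measures is used. *)
Lemma lipschitz_outer_measure (f : R -> R) (E : set R) (L : R) : 0 < L ->
  (forall x y, E x -> E y -> `|f x - f y| <= L * `|x - y|) ->
  (mu (f @` E) <= (L *+ 2)%:E * mu E)%E.
Proof.
move=> L0 fL; have L20 : 0 < L *+ 2 by rewrite pmulrn_rgt0.
rewrite -lee_pdivrMl// [mu E]outer_measure_open_itv_cover.
apply: le_ereal_inf_tmp => _ [F [Fitv EF] <-]; rewrite lee_pdivrMl//.
apply: (@le_trans _ _ (\sum_(k <oo) mu (f @` (E `&` F k)))%E).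
  apply: le_trans (outer_measure_sigma_subadditive (wlength idfun)^*%mu _).
  apply: le_mu => _ [x Ex <-]; have [k _ Fkx] := EF x Ex.
  by exists k => //; exists x.
rewrite -nneseriesZl; last first.
  by move=> k _; have [[a b] ->] := Fitv k; exact: wlength_itv_ge0.
apply: lee_nneseries => [k _ _|k _]; first exact: measure_ge0.
have [[a b] /= ->] := Fitv k.
have [->|/set0P[x [Ex]]] := eqVneq (E `&` `]a, b[) set0.
  by rewrite image_set0 measure0 mule_ge0 ?wlength_itv_ge0// lee_fin ltW.
rewrite /= in_itv/= => /andP[ax xb].
have ab : a < b by exact: lt_trans xb.
rewrite wlength_itv/= lte_fin ab -EFinD -EFinM.
pose r := L * (b - a).
apply: (@le_trans _ _ (lebesgue_measure `[f x - r, f x + r])).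
  apply: le_mu => z [y [Ey /=]]; rewrite in_itv/= => /andP[ay yb] <-{z}.
  rewrite /= in_itv/= -ler_distl distrC.
  apply: le_trans (fL _ _ Ex Ey) _; rewrite ler_pM2l// ler_norml.
  by apply/andP; split; lra.
have r0 : 0 < r by rewrite mulr_gt0// subr_gt0.
rewrite lebesgue_measure_itv/= lte_fin ifT; last lra.
by rewrite -EFinD lee_fin /r; lra.
Qed.

Lemma inv_outer_measure (c : R) (E : set R) :
  0 < c -> E `<=` [set x | c <= x] ->
  (mu (GRing.inv @` E) <= (c ^- 2 *+ 2)%:E * mu E)%E.
Proof.
move=> c0 Ec; apply: lipschitz_outer_measure.
  by rewrite invr_gt0 exprn_gt0.
move=> x y /Ec/= cx /Ec/= cy.
have x0 : 0 < x by exact: lt_le_trans cx.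
have y0 : 0 < y by exact: lt_le_trans cy.
have -> : x^-1 - y^-1 = (x * y)^-1 * (y - x).
  by field; rewrite !gt_eqF.
rewrite normrM distrC gtr0_norm ?invr_gt0 ?mulr_gt0//.
rewrite ler_wpM2r// lef_pV2 ?posrE ?exprn_gt0 ?mulr_gt0//.
by rewrite expr2 ler_pM// ltW.
Qed.

(** Inversion is not Lipschitz near [0], so the null set is cut into the pieces
    lying in the half-lines starting at [1/(n+1)]. *)
Lemma negligible_inv (N : set R) : N `<=` [set x | 0 < x] ->
  (@lebesgue_measure R).-negligible N ->
  (@lebesgue_measure R).-negligible (GRing.inv @` N).
Proof.
move=> N0 nN; pose F n := GRing.inv @` (N `&` [set x | n.+1%:R^-1 <= x]).
have -> : GRing.inv @` N = \bigcup_n F n.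
  apply/seteqP; split=> [_ [x Nx <-]|_ [n _ [x [Nx _] <-]]]; last by exists x.
  have x0 : 0 < x by exact: N0.
  exists (Num.truncn x^-1) => //; exists x => //; split => //=.
  rewrite invf_ple ?posrE// ltW//.
  by rewrite truncnS_gt.
apply: negligible_bigcup => n; apply/negligible_outer_measure.
apply/eqP; rewrite eq_le outer_measure_ge0 andbT.
have n0 : 0 < n.+1%:R^-1 :> R by rewrite invr_gt0.
apply: le_trans (inv_outer_measure n0 _) _; first exact: subIsetr.
suff -> : mu (N `&` [set x | n.+1%:R^-1 <= x]) = 0%E by rewrite mule0.
by apply/negligible_outer_measure; apply: negligibleS nN; exact: subIsetl.
Qed.

Lemma measurable_inv_preimage (A : set R) : measurable A ->
  measurable ([set x | 0 < x] `&` GRing.inv @^-1` A).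
Proof.
move=> mA; suff mV : measurable_fun [set x : R | 0 < x] GRing.inv.
  by apply: mV => //; apply: open_measurable; exact: open_gt.
apply: open_continuous_measurable_fun; first exact: open_gt.
by move=> x /set_mem/= x0; apply: inv_continuous; rewrite gt_eqF.
Qed.

Lemma Lebesgue_measurable_inv (U : set R) : Lebesgue_measurable U ->
  Lebesgue_measurable ([set x | 0 < x] `&` GRing.inv @^-1` U).
Proof.
move=> [A mA [N nN <-]].
exists ([set x | 0 < x] `&` GRing.inv @^-1` A).
  exact: measurable_inv_preimage.
exists ([set x | 0 < x] `&` GRing.inv @^-1` N).
  apply: negligibleS (negligible_inv (N := N `&` [set x | 0 < x]) _ _) => //.
  - move=> x [/= x0 Nx]; exists x^-1; rewrite ?invrK//; split => //=.
    by rewrite invr_gt0.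
  - by apply: negligibleS nN; exact: subIsetl.
by rewrite -setIUr preimage_setU.
Qed.

Let caratheodoryE (A X : set R) : Lebesgue_measurable A ->
  mu X = (mu (X `&` A) + mu (X `&` ~` A))%E.
Proof.
rewrite /Lebesgue_measurable -g_sigma_completed_algebra_genE.
by rewrite completed_caratheodory_measurable; apply.
Qed.

Lemma mu_window (t d : R) : 0 < d ->
  mu (`]t - d / 2, t + d / 2[ : set R) = d%:E.
Proof.
move=> d0; transitivity (lebesgue_measure (`]t - d / 2, t + d / 2[ : set R)).
  by [].
rewrite lebesgue_measure_itv/= lte_fin ifT; last lra.
by rewrite -EFinD; congr EFin; lra.
Qed.

(** The upper bound that Lipschitz maps give for outer measures is useful for
    small sets, so density [1] of [U] is traded for density [0] of its
    complement.  Measurability of [U] makes the two proportions add up to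
    [1]. *)
Lemma density_pointC (U : set R) t : Lebesgue_measurable U ->
  density_point U t <->
  (mu (~` U `&` [set` `]t - d / 2, t + d / 2[%R]) * (d^-1)%:E)%E
    @[d --> 0^'+] --> 0%:E.
Proof.
move=> mU.
pose r (W : set R) d := (mu (W `&` [set` `]t - d / 2, t + d / 2[%R]) *
  (d^-1)%:E)%E.
have r1 : \forall d \near 0^'+, (r U d + r (~` U) d = 1%:E)%E.
  near=> d; have d0 : 0 < d by [].
  rewrite /r -muleDl//; last by rewrite ge0_adde_def// inE measure_ge0.
  rewrite ![_ `&` [set` _]]setIC -caratheodoryE// mu_window//.
  by rewrite -EFinM divff ?gt_eqF.
have rfin W : \forall d \near 0^'+, (r W d \is a fin_num)%E.
  near=> d; have d0 : 0 < d by [].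
  rewrite fin_numM// ge0_fin_numE ?measure_ge0//.
  apply: (@le_lt_trans _ _ d%:E); last by rewrite ltry.
  by rewrite -(mu_window t d0); apply: le_mu; exact: subIsetr.
split=> rU.
- have -> : 0%:E = (1%:E - 1%:E)%E :> \bar R by rewrite subee.
  apply: cvg_trans (cvgeB _ (cvg_cst 1%:E) rU) => //.
  apply: near_eq_cvg; near=> d; rewrite -/(r U d) -/(r (~` U) d).
  have <- : (r U d + r (~` U) d = 1%:E)%E by near: d.
  by rewrite addeAC subee ?add0e//; near: d.
- rewrite /density_point.
  have -> : 1%:E = (1%:E - 0%:E)%E :> \bar R by rewrite sube0.
  apply: cvg_trans (cvgeB _ (cvg_cst 1%:E) rU) => //.
  apply: near_eq_cvg; near=> d; rewrite -/(r U d) -/(r (~` U) d).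
  have <- : (r U d + r (~` U) d = 1%:E)%E by near: d.
  by rewrite addeK//; near: d.
Unshelve. all: by end_near. Qed.

(** For a window around [t] of width [d < t], points stay in the interval from
    [t/2] to [3t/2]; there [1/x] is at least [1/(2t)], and its distance to
    [1/t] is at most [2/t^2] times that of [x] to [t]. *)
Lemma inv_window (t d x : R) : 0 < d -> d < t -> t - d / 2 < x < t + d / 2 ->
  [/\ 0 < x, (t *+ 2)^-1 <= x^-1 &
      t^-1 - 2 / t ^+ 2 * d / 2 < x^-1 < t^-1 + 2 / t ^+ 2 * d / 2].
Proof.
move=> d0 dt /andP[tx xt]; have t0 : 0 < t by lra.
have x0 : 0 < x by lra.
split => //; first by rewrite lef_pV2 ?posrE ?pmulrn_rgt0//; lra.
rewrite -ltr_distl.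
have -> : x^-1 - t^-1 = (t - x) / (x * t) by field; rewrite !gt_eqF.
have -> : 2 / t ^+ 2 * d / 2 = (d / 2) / ((t / 2) * t).
  by field; rewrite gt_eqF.
rewrite normrM [`|_^-1|]gtr0_norm ?invr_gt0 ?mulr_gt0//.
apply: ltr_pM => //; first by rewrite invr_ge0 mulr_ge0// ltW.
  by rewrite ltr_norml; apply/andP; split; lra.
rewrite ltf_pV2 ?posrE ?mulr_gt0// ltr_pM2r//; lra.
Qed.

(** The complement of the inverse set in the window of width [d] around [t] is
    the image of part of the complement of [U] in the window of width [k * d]
    around [1/t], so its proportion there is at most a constant multiple of the
    latter's, which tends to [0]. *)
Lemma density_point_inv (U : set R) (t : R) : Lebesgue_measurable U -> 0 < t ->
  density_point U t^-1 ->
  density_point ([set x | 0 < x] `&` GRing.inv @^-1` U) t.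
Proof.
move=> mU t0 /(density_pointC _ mU) dU.
apply/density_pointC; first exact: Lebesgue_measurable_inv.
set V := _ `&` _; pose k := 2 / t ^+ 2; pose c := (t *+ 2)^-1.
have k0 : 0 < k by rewrite divr_gt0// exprn_gt0.
have c0 : 0 < c by rewrite invr_gt0 pmulrn_rgt0.
pose r d := (mu (~` U `&` [set` `]t^-1 - d / 2, t^-1 + d / 2[%R]) *
  (d^-1)%:E)%E.
(* Scaling the window width by [k] leaves the limit at 0 from the right
   unchanged. *)
have rk : ((c ^- 2 *+ 2 * k)%:E * r (k * d)%R)%E @[d --> 0^'+] --> 0%:E.
  rewrite -[X in _ --> X](mule0 (c ^- 2 *+ 2 * k)%:E).
  apply: cvgeZl => //; apply: (@cvg_comp _ _ _ ( *%R k) r _ _ _ _ dU).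
  move=> A [e /= e0 eA]; exists (e / k) => /=; first exact: divr_gt0.
  move=> d /= de d0; apply: eA; last by rewrite /= mulr_gt0.
  move: de; rewrite /= !sub0r !normrN normrM (gtr0_norm k0).
  by rewrite ltr_pdivlMr// mulrC.
apply: (squeeze_cvge _ (@cvg_cst _ 0%:E _ _ _) rk).
near=> d; have d0 : 0 < d by [].
have dt : d < t by near: d; exact: nbhs_right_lt.
apply/andP; split.
  by rewrite mule_ge0 ?measure_ge0// lee_fin invr_ge0 ltW.
have -> : ((c ^- 2 *+ 2 * k)%:E * r (k * d)%R = (c ^- 2 *+ 2)%:E *
    mu (~` U `&` [set` `]t^-1 - k * d / 2, t^-1 + k * d / 2[%R]) *
    (d^-1)%:E)%E.
  rewrite /r muleCA [RHS]muleAC -!EFinM muleC.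
  by congr (_%:E * _)%E; field; rewrite !gt_eqF.
rewrite lee_pmul2r// ?lte_fin ?invr_gt0//.
have UW : ~` V `&` [set` `]t - d / 2, t + d / 2[%R] `<=` GRing.inv @`
    ((~` U `&` [set` `]t^-1 - k * d / 2, t^-1 + k * d / 2[%R]) `&`
     [set y | c <= y]).
  move=> x [nVx]; rewrite /= in_itv/= => /(inv_window d0 dt)[x0 cx kx].
  exists x^-1; last by rewrite invrK.
  split => //; split; last by rewrite /= in_itv.
  by move=> Ux; apply: nVx.
apply: (le_trans (le_mu UW)).
apply: (le_trans (inv_outer_measure c0 (@subIsetr _ _ _))).
rewrite lee_pmul2l ?lte_fin ?pmulrn_rgt0 ?invr_gt0 ?exprn_gt0//.
by apply: le_mu; exact: subIsetl.
Unshelve. all: by end_near. Qed.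

Lemma density_open_inv (U : set R) : density_open U ->
  density_open ([set x | 0 < x] `&` GRing.inv @^-1` U).
Proof.
move=> [mU dU]; split; first exact: Lebesgue_measurable_inv.
by move=> t [/= t0 Ut]; apply: density_point_inv => //; exact: dU.
Qed.

Lemma open_inv (U : set R) : open U ->
  open ([set x | 0 < x] `&` GRing.inv @^-1` U).
Proof.
rewrite !openE => oU t [/= t0 /oU Ut]; apply: filterI.
  by apply: open_nbhs_nbhs; split => //; exact: open_gt.
by apply: inv_continuous => //; rewrite gt_eqF.
Qed.

End density_of_inverse.

(** * Inversion as a homeomorphism of the half-line *)

Section Rplus_inv.
Context {R : realType} {tau : line_topology}.
Local Notation X := (Rplus R tau).

Lemma Rplus_invK : involutive (@Rplus_inv R tau).
Proof. by move=> x; apply: val_inj; exact: invrK. Qed.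

Lemma image_Rplus_inv (A : set X) : Rplus_inv @` A = Rplus_inv @^-1` A.
Proof.
apply/seteqP; split=> [_ [x Ax <-]|x Ax]; first by rewrite /= Rplus_invK.
by exists (Rplus_inv x) => //; exact: Rplus_invK.
Qed.

Lemma line_open_inv (U : set R) : @line_open R tau U ->
  @line_open R tau ([set x | 0 < x] `&` GRing.inv @^-1` U).
Proof.
by rewrite /line_open; case: tau; [exact: open_inv|exact: density_open_inv].
Qed.

Lemma Rplus_inv_continuous : continuous (@Rplus_inv R tau).
Proof.
apply/continuousP => _ [U oU <-].
exists ([set x | 0 < x] `&` GRing.inv @^-1` U); first exact: line_open_inv.
apply/seteqP; split=> [x []//|x Ux]; split => //; exact: Rplus_val_gt0.
Qed.

Lemma Rplus_inv_homeo : self_homeomorphism (@Rplus_inv R tau).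
Proof.
split; first exact: Rplus_inv_continuous.
exists Rplus_inv; split; [exact: Rplus_inv_continuous|exact: Rplus_invK..].
Qed.

(** * Unboundedly many hits *)

Lemma essentially_unboundedY (S U : set X) : meagre (S `+` U) ->
  essentially_unbounded S -> essentially_unbounded U.
Proof.
move=> mSU uS m m0 mU; apply: (uS m m0).
apply: meagreS (meagreU mU mSU) => x [Sx mx].
by have [Ux|nUx] := pselect (U x); [left|right; left].
Qed.

Lemma cofinal_unbounded_indices (K : index_kind) (J : set (index_type K)) :
  (forall i : index_type K, exists2 j, val i <= val j & J j) ->
  unbounded_indices J.
Proof.
move=> cJ [q ubq].
have [i qi] : exists i : index_type K, q < val i.
  (* A positive integer is an index of each of the three kinds. *)
  have q0 : 0 < (Num.truncn q).+1%:R :> rat by rewrite ltr0n.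
  have iK : is_index K (Num.truncn q).+1%:R.
    by case: (K) => //=; rewrite q0 ?natr_nat.
  by exists (exist (fun q => is_index K q) _ iK); rewrite /= truncnS_gt.
have [j ij Jj] := cJ i.
have : val j <= q by apply: ubq; exists j.
by rewrite leNgt (lt_le_trans qi).
Qed.

(** For each of the countably many pairs [(k, j)], quasi all points are sent
    into [S k] by some [h i] with [j <= i]; outside the union of the exceptional
    sets the hitting indices are cofinal for every [k].  The weakly Archimedean
    condition is applied to the open set [U] that [S k] agrees with modulo a
    meagre set, rather than to [S k], so that the points hitting it form an
    open set. *)
Lemma quasi_all_unbounded_hits (K : index_kind) (h : index_type K -> X -> X)
    (S : nat -> set X) :
  (forall i, self_homeomorphism (h i)) -> weakly_archimedean h ->
  (forall k, (0 < k)%N -> baire_set (S k)) ->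
  (forall k, (0 < k)%N -> essentially_unbounded (S k)) ->
  quasi_all (fun eta => forall k, (0 < k)%N ->
    unbounded_indices [set j | S k (h j eta)]).
Proof.
move=> hh hA bS uS.
(* Writing the index type as a sigma type makes it visibly countable. *)
have hit (p : nat * {q : rat | is_index K q}) :
    meagre [set eta | (0 < p.1)%N /\
      ~ exists2 i : index_type K, val p.2 <= val i & S p.1 (h i eta)].
  case: p => k j /=; have [k0|k0] := posnP k.
    apply: meagreS (nowhere_dense_meagre _); last exact: nowhere_dense0.
    by move=> x [].
  have [U oU mSU] := bS k k0.
  apply: (@meagreS _ _ [set eta |
     ~ exists2 i : index_type K, val j <= val i & S k (h i eta)]).
    by move=> x [].
  apply: (@quasi_all_hit X {q : rat | is_index K q} [set i | val j <= val i]
    h (S k) U) => // V oV V0.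
  apply: hA => //; first exact: open_baire_set.
  exact: essentially_unboundedY mSU (uS k k0).
apply: meagreS (meagre_bigcup hit) => eta /= nP.
apply: contrapT => nhit; apply: nP => k k0.
apply: cofinal_unbounded_indices => i; apply: contrapT => ni.
by apply: nhit; exists (k, i).
Qed.

End Rplus_inv.

Theorem theorem3p5 (R : realType) (tau : line_topology) (K : index_kind)
    (h : index_type K -> Rplus R tau -> Rplus R tau)
    (h_homeo : forall i : index_type K, self_homeomorphism (h i))
    (h_arch : weakly_archimedean h) :
  (forall S : nat -> set (Rplus R tau),
    (forall k, (0 < k)%N -> baire_set (S k)) ->
    (forall k, (0 < k)%N -> essentially_unbounded (S k)) ->
    quasi_all (fun eta : Rplus R tau => forall k, (0 < k)%N ->
      exists J : set (index_type K), unbounded_indices J /\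
        [set h j eta | j in J] `<=` S k))
  /\
  (forall A : nat -> set (Rplus R tau),
    (forall k, (0 < k)%N -> baire_set (A k)) ->
    (forall k, (0 < k)%N -> essential_accumulation_at_0 (A k)) ->
    quasi_all (fun eta : Rplus R tau => forall k, (0 < k)%N ->
      exists J : set (index_type K), unbounded_indices J /\
        [set Rplus_inv (h j eta) | j in J] `<=` A k)).
Proof.
split=> [S bS uS|A bA uA].
  apply: meagreS (quasi_all_unbounded_hits h_homeo h_arch bS uS) => eta.
  apply: contra_not => hit k k0; exists [set j | S k (h j eta)].
  by split; [exact: hit|move=> _ [j Sj <-]].
have bS k : (0 < k)%N -> baire_set (Rplus_inv @^-1` A k).
  by move=> k0; apply: baire_set_preimage (bA k k0); exact: Rplus_inv_homeo.
have uS k : (0 < k)%N -> essentially_unbounded (Rplus_inv @^-1` A k).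
  by move=> k0; rewrite -image_Rplus_inv; exact: uA.
apply: meagreS (quasi_all_unbounded_hits h_homeo h_arch bS uS) => eta.
apply: contra_not => hit k k0; exists [set j | A k (Rplus_inv (h j eta))].
by split; [exact: hit|move=> _ [j Aj <-]].
Qed.
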